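(* Let $N\ge 1$ and $d$ be integers and let $0\le m_1<m_2<\dots<m_N<d$ be integers. Then the $(N+1)$-dimensional subspace $$V=\mathrm{Span}\{P_{m_1;d}(x),\dots,P_{m_N;d}(x),P_{d;d}(x)\}\subset \mathrm{Poly}_d$$ is the unique element of the Schubert intersection $$\Omega_{\mathbf a}(0)\cap\Omega_{(d-N)}(-1)\cap\Omega_{\mathbf w}(\infty)\subset Gr_{N+1}(\mathrm{Poly}_d),$$ where $\mathbf a=(m_N+1-N,\dots,m_2-1,m_1)$ (i.e. $a_l=m_{N+1-l}-(N-l)$, $1\le l\le N$) and $\mathbf w=(d-m_1-N,\dots,d-m_{N-1}-2,d-m_N-1)$ (i.e. $w_l=d-m_l-(N+1-l)$, $1\le l\le N$), and $(d-N)$ denotes the special partition $(d-N,0,\dots,0)$.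
   Context: For integers $1\le m\le d$ (and also $m=0$), the truncated binomial is $P_{m;d}(x)=\sum_{j=0}^{m}\binom{d}{j}x^j$; in particular $P_{d;d}(x)=(x+1)^d$. $\mathrm{Poly}_d$ is the complex vector space of polynomials in $x$ of degree at most $d$, and $Gr_{N+1}(\mathrm{Poly}_d)$ is the Grassmannian of $(N+1)$-dimensional subspaces (of dimension $(N+1)(d-N)$). For $\xi\in\mathbb C$, the osculating flag $\mathcal F_\bullet(\xi)$ has $\mathcal F_j(\xi)=\{f\in\mathrm{Poly}_d:(x-\xi)^{d-j}\mid f\}$, $0\le j\le d$; for $\xi=\infty$, $\mathcal F_j(\infty)=\mathrm{Poly}_j$. A partition is $\mathbf w=(w_1,\dots,w_N)$ with $d-N\ge w_1\ge\dots\ge w_N\ge 0$; set $w_{N+1}=0$. The Schubert cell $\Omega^\circ_{\mathbf w}(\xi)$ is the set of $V\in Gr_{N+1}(\mathrm{Poly}_d)$ with $\dim(V\cap\mathcal F_{d-N-1+i-w_i}(\xi))=i$ and $\dim(V\cap\mathcal F_{d-N-2+i-w_i}(\xi))=i-1$ for $i=1,\dots,N+1$; the Schubert variety $\Omega_{\mathbf w}(\xi)$ is its closure. (Equivalently, the orders at $\xi$ of the nonzero polynomials of $V$ — order at $\infty$ of $f$ being $d-\deg f$ — include the values $w_{N+2-i}+i-1$... i.e. the cell prescribes the $N+1$ distinct orders $w_l+N+1-l$, $1\le l\le N+1$.) *)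

(* Defs.v *)
From HB Require Import structures.
From mathcomp Require Import all_boot all_order all_algebra.
From mathcomp Require Import complex.
From mathcomp Require Import all_classical all_reals topology normedtype.
Unset Printing Implicit Defensive.
Import Order.TTheory GRing.Theory Num.Theory.
Import numFieldNormedType.Exports.
Local Open Scope classical_set_scope.
Local Open Scope ring_scope.

Section Schubert.
Variable R : realType.
Local Notation C := (R[i]).

Definition trunc_binom (m d : nat) : {poly C} :=
  \sum_(j < m.+1) 'C(d, j)%:R *: 'X^j.

Definition Polyd (d : nat) := {poly_(d.+1) C}.

Definition topolyd (d : nat) (p : {poly C}) : Polyd d := insubd (0 : Polyd d) p.

(* osculating flag: F_j(xi) = (x - xi)^(d-j) * Poly_j inside Poly_d;
   F_j(infinity) = Poly_j.  [xi = None] encodes infinity. *)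
Definition osc_flag (d : nat) (xi : option C) (j : nat) : {vspace Polyd d} :=
  <<[seq topolyd d
       ((if xi is Some z then ('X - z%:P) ^+ (d - j) else 1) * 'X^k)
     | k <- iota 0 j.+1]>>%VS.

Definition flag_sh (d : nat) (xi : option C) (k : nat) : {vspace Polyd d} :=
  if k is k'.+1 then osc_flag d xi k' else 0%VS.

(* partition w = (w_1,...,w_N) (1-indexed), extended by w_{N+1} = 0 *)
Definition wext (N : nat) (w : nat -> nat) (i : nat) : nat :=
  if (i <= N)%N then w i else 0%N.

Definition schubert_cell (N d : nat) (w : nat -> nat) (xi : option C)
    (V : {vspace Polyd d}) : Prop :=
  \dim V = N.+1 /\
  forall i, (1 <= i <= N.+1)%N ->
    let k := (d - N + i - wext N w i)%N in
    \dim (V :&: flag_sh d xi k)%VS = i /\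
    \dim (V :&: flag_sh d xi k.-1)%VS = i.-1.

(* Schubert variety Omega_w(xi) = closure of the cell in the classical
   topology of Gr_{N+1}(Poly_d): V is in the closure iff some (equivalently,
   any) basis of V is the coefficientwise limit of bases of points of the
   cell. *)
Definition schubert_variety (N d : nat) (w : nat -> nat) (xi : option C)
    (V : {vspace Polyd d}) : Prop :=
  exists (B : nat -> 'I_N.+1 -> Polyd d) (B0 : 'I_N.+1 -> Polyd d),
    [/\ forall n, free (map (B n) (enum 'I_N.+1)) /\
                  schubert_cell N d w xi <<map (B n) (enum 'I_N.+1)>>%VS,
        free (map B0 (enum 'I_N.+1)),
        V = <<map B0 (enum 'I_N.+1)>>%VS &
        forall (i : 'I_N.+1) (c : nat),
          (fun n => (complex.Re ((B n i : {poly C})`_c) : R)) @ \oo -->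
            (complex.Re ((B0 i : {poly C})`_c) : R)
          /\ (fun n => (complex.Im ((B n i : {poly C})`_c) : R)) @ \oo -->
            (complex.Im ((B0 i : {poly C})`_c) : R)].

End Schubert.

(* Main.v *)
(* Pairing the conditions at infinity and at 0: U in the intersection has, for
   each l, at least l dimensions of polynomials of degree <= m_l and at least
   N + 1 - l dimensions of polynomials divisible by x^(m_l + 1). These two parts
   meet trivially, so U is their direct sum; the condition at -1 puts (x + 1)^d
   in U, and its component of degree <= m_l is P_{m_l;d}. The dimension bounds
   pass from a Schubert cell to its closure by lower semicontinuity of the rank.

   For existence, V lies in each of the three cells, not just in the closures:
   at 0 and infinity by the orders of (x + 1)^d - P_{m_l;d} and the degrees of
   P_{m_l;d}. At -1, the operator (x + 1) d/dx - d kills (x + 1)^d and sends V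
   into the span of the N monomials x^(m_l), in which no nonzero polynomial
   vanishes to order N at -1; hence (x + 1)^d is, up to scalars, the only
   element of V vanishing there to order >= N. *)
Require Import Defs.
From HB Require Import structures.
From mathcomp Require Import all_boot all_order all_algebra.
From mathcomp Require Import complex.
From mathcomp Require Import all_classical all_reals topology normedtype.
From mathcomp Require Import zify.
Import Order.TTheory GRing.Theory Num.Theory.
Import numFieldNormedType.Exports VectorInternalTheory.
Local Open Scope ring_scope.

(** * Linear algebra of spans and intersections *)

Lemma span_ind (K : fieldType) (vT : vectType K) (X : seq vT)
    (P : vT -> Prop) : P 0 ->
  (forall k u v, P u -> P v -> P (k *: u + v)) ->
  {in X, forall x, P x} -> {in <<X>>%VS, forall v, P v}.
Proof.
move=> P0 PD; elim: X => [_ v|x X IH PX v].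
  by rewrite span_nil memv0 => /eqP->.
rewrite span_cons => /memv_addP[_ /vlineP[k ->] [u uX ->]].
apply: PD; first exact: PX (mem_head _ _).
by apply: IH uX => y yX; apply: PX; rewrite inE yX orbT.
Qed.

Lemma dim_span_enum (K : fieldType) (vT : vectType K) (n : nat)
    (g : 'I_n -> vT) :
  \dim <<map g (enum 'I_n)>>%VS = \rank (\matrix_i v2r (g i)).
Proof.
have span_b2mx (X : n.-tuple vT) : <<X>>%VS = mx2vs (b2mx X).
  by rewrite unlock tvalK; case: _ / (esym _).
have -> : map g (enum 'I_n) = [tuple g i | i < n] by [].
rewrite span_b2mx /dimv genmxE; congr mxrank.
by apply/row_matrixP => i; rewrite !rowK tnth_mktuple.
Qed.

Lemma lker_subid_projv (K : fieldType) (vT : vectType K) (F : {vspace vT}) :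
  lker (\1 - projv F)%VF = F.
Proof.
apply/vspaceP=> v; rewrite memv_ker add_lfunE opp_lfunE id_lfunE subr_eq0.
apply/eqP/idP => [->|/projv_id->//]; exact: memv_proj.
Qed.

(** Rank-nullity for [\1 - projv F], whose kernel is [F]. It trades the dimension of an intersection
    with a fixed [F] for the rank of a matrix depending linearly on the family [g]. *)
Lemma dim_cap_lker_span (K : fieldType) (vT : vectType K) (n : nat)
    (g : 'I_n -> vT) (F : {vspace vT}) : free (map g (enum 'I_n)) ->
  (\dim (<<map g (enum 'I_n)>> :&: F)
   + \rank (\matrix_i v2r (g i - projv F (g i))) = n)%N.
Proof.
move=> /eqP; rewrite size_map size_enum_ord => dg.
rewrite -[RHS]dg -[RHS](limg_ker_dim (\1 - projv F)%VF) lker_subid_projv.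
congr addn.
rewrite limg_span -map_comp dim_span_enum; congr mxrank.
by apply/matrixP=> i j; rewrite !mxE /= add_lfunE opp_lfunE id_lfunE.
Qed.

(** * Complex limits and semicontinuity of the rank *)

Section ComplexLimits.
Variable R : realType.
Local Notation C := R[i].
Local Open Scope classical_set_scope.

(** Componentwise form, matching the closure condition in [schubert_variety]. *)
Definition ccvg (u : nat -> C) (l : C) :=
  ((fun n => complex.Re (u n)) @ \oo --> (complex.Re l : R))
  /\ ((fun n => complex.Im (u n)) @ \oo --> (complex.Im l : R)).

Lemma ccvg_cst (l : C) : ccvg (fun=> l) l.
Proof. by split; exact: cvg_cst. Qed.

Lemma ccvg_unique (u : nat -> C) (l l' : C) : ccvg u l -> ccvg u l' -> l = l'.
Proof.
move=> [ur ui] [ur' ui']; apply/eqP; rewrite eq_complex; apply/andP; split.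
  by apply/eqP; exact: (cvg_unique _ ur ur').
by apply/eqP; exact: (cvg_unique _ ui ui').
Qed.

Lemma ccvgD (u v : nat -> C) (k l : C) :
  ccvg u k -> ccvg v l -> ccvg (fun n => u n + v n) (k + l).
Proof.
move=> [ur ui] [vr vi].
by split; rewrite !raddfD; under eq_fun do rewrite raddfD; apply: cvgD.
Qed.

Lemma ccvgM (u v : nat -> C) (k l : C) :
  ccvg u k -> ccvg v l -> ccvg (fun n => u n * v n) (k * l).
Proof.
move=> [ur ui] [vr vi].
have ReM (x y : C) : complex.Re (x * y)
    = complex.Re x * complex.Re y - complex.Im x * complex.Im y.
  by case: x y => [a b] [c e].
have ImM (x y : C) : complex.Im (x * y)
    = complex.Re x * complex.Im y + complex.Im x * complex.Re y.
  by case: x y => [a b] [c e].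
split.
  rewrite ReM; under eq_fun do rewrite ReM.
  by apply: cvgB; apply: cvgM.
rewrite ImM; under eq_fun do rewrite ImM.
by apply: cvgD; apply: cvgM.
Qed.

Lemma ccvg_sum (I : Type) (s : seq I) (P : pred I) (u : I -> nat -> C)
    (l : I -> C) : (forall i, ccvg (u i) (l i)) ->
  ccvg (fun n => \sum_(i <- s | P i) u i n) (\sum_(i <- s | P i) l i).
Proof.
move=> ul; elim: s => [|i s IH].
  by rewrite big_nil; under eq_fun do rewrite big_nil; exact: ccvg_cst.
rewrite big_cons; under eq_fun do rewrite big_cons.
by case: (P i) => //; exact: ccvgD.
Qed.

Lemma ccvg_prod (I : Type) (s : seq I) (P : pred I) (u : I -> nat -> C)
    (l : I -> C) : (forall i, ccvg (u i) (l i)) ->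
  ccvg (fun n => \prod_(i <- s | P i) u i n) (\prod_(i <- s | P i) l i).
Proof.
move=> ul; elim: s => [|i s IH].
  by rewrite big_nil; under eq_fun do rewrite big_nil; exact: ccvg_cst.
rewrite big_cons; under eq_fun do rewrite big_cons.
by case: (P i) => //; exact: ccvgM.
Qed.

Definition mxcvg (m n : nat) (M : nat -> 'M[C]_(m, n)) (M0 : 'M[C]_(m, n)) :=
  forall i j, ccvg (fun k => M k i j) (M0 i j).

Lemma mxcvg_cst (m n : nat) (M : 'M[C]_(m, n)) : mxcvg m n (fun=> M) M.
Proof. by move=> i j; exact: ccvg_cst. Qed.

Lemma mxcvg_mul (m n p : nat) (A : nat -> 'M[C]_(m, n)) A0
    (B : nat -> 'M[C]_(n, p)) B0 :
  mxcvg m n A A0 -> mxcvg n p B B0 ->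
  mxcvg m p (fun k => A k *m B k) (A0 *m B0).
Proof.
move=> Acvg Bcvg i j; rewrite mxE; under eq_fun do rewrite mxE.
by apply: ccvg_sum => k; exact: ccvgM.
Qed.

(** By the Leibniz formula the determinant is a polynomial in the entries. *)
Lemma ccvg_det (n : nat) (M : nat -> 'M[C]_n) (M0 : 'M[C]_n) :
  mxcvg n n M M0 -> ccvg (fun k => \det (M k)) (\det M0).
Proof.
move=> Mcvg; apply: ccvg_sum => s; apply: ccvgM; first exact: ccvg_cst.
by apply: ccvg_prod => i.
Qed.

(* If rank M0 = s, some L *m M0 *m Q is the identity of size s, and the
   determinants of the L *m M k *m Q converge to 1. *)
Lemma mxrank_limit_le (m n r : nat) (M : nat -> 'M[C]_(m, n)) M0 :
  mxcvg m n M M0 -> (forall k, \rank (M k) <= r)%N -> (\rank M0 <= r)%N.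
Proof.
move=> Mcvg Mr; rewrite leqNgt; apply/negP => rs.
set s := \rank M0 in rs.
pose L : 'M[C]_(s, m) := pid_mx s *m invmx (col_ebase M0).
pose Q : 'M[C]_(n, s) := invmx (row_ebase M0) *m pid_mx s.
have LMQ : L *m M0 *m Q = 1%:M.
  rewrite -{1}(mulmx_ebase M0) /L /Q !mulmxA mulmxKV ?col_ebase_unit //.
  rewrite mulmxK ?row_ebase_unit // -/s !mul_pid_mx.
  have -> : minn n (minn (minn m (minn s s)) s) = s.
    have := rank_leq_row M0; have := rank_leq_col M0; rewrite -/s; lia.
  by rewrite pid_mx_1.
have /ccvg_det : mxcvg s s (fun k => L *m M k *m Q) 1%:M.
  rewrite -LMQ; apply: mxcvg_mul; last exact: mxcvg_cst.
  by apply: mxcvg_mul => //; exact: mxcvg_cst.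
have -> : (fun k => \det (L *m M k *m Q)) = fun=> 0.
  apply/funext => k; apply/eqP.
  (* The product factors through [M k], so it has rank at most [r < s] and is singular. *)
  rewrite -[_ == 0]negbK -unitfE -unitmxE -row_free_unit.
  rewrite -row_leq_rank -ltnNge (leq_ltn_trans _ rs) //.
  rewrite (leq_trans (mxrankM_maxl _ _)) //.
  by rewrite (leq_trans (mxrankM_maxr _ _)).
move=> /ccvg_unique/(_ (ccvg_cst 0)) /eqP.
by rewrite det1 oner_eq0.
Qed.

(** In the monomial basis, each coordinate of [f p] is a fixed linear combination of the
    coefficients of [p]. *)
Lemma ccvg_linear (d n : nat) (f : {linear Polyd R d -> 'rV[C]_n})
    (p : nat -> Polyd R d) (p0 : Polyd R d) j :
  (forall c : nat, ccvg (fun k => (p k : {poly C})`_c) (p0 : {poly C})`_c) ->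
  ccvg (fun k => f (p k) 0 j) (f p0 0 j).
Proof.
move=> pp0.
have E (q : Polyd R d) :
    f q 0 j = \sum_(c < d.+1) (q : {poly C})`_c * f (npolyX C d.+1)`_c 0 j.
  rewrite [q in LHS](coord_basis (npolyX_full C d.+1)) ?memvf //.
  rewrite linear_sum summxE; apply: eq_bigr => c _.
  by rewrite linearZ mxE npolyX_coords.
rewrite E; under eq_fun do rewrite E.
apply: ccvg_sum => c; apply: ccvgM => //; exact: ccvg_cst.
Qed.

(** The residues of the basis vectors modulo [F] form matrices of rank at most [n - i], and this
    bound survives the limit. *)
Lemma dim_cap_limit_ge (d n i : nat) (F : {vspace Polyd R d})
    (B : nat -> 'I_n -> Polyd R d) (B0 : 'I_n -> Polyd R d) :
  (forall k, free (map (B k) (enum 'I_n))) -> free (map B0 (enum 'I_n)) ->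
  (forall j (c : nat), ccvg (fun k => (B k j : {poly C})`_c)
      (B0 j : {poly C})`_c) ->
  (forall k, i <= \dim (<<map (B k) (enum 'I_n)>> :&: F))%N ->
  (i <= \dim (<<map B0 (enum 'I_n)>> :&: F))%N.
Proof.
move=> Bfree B0free Bcvg Bi.
(* Makes the truncated subtraction [n - i] exact. *)
have iN : (i <= n)%N.
  rewrite -[X in (_ <= X)%N](dim_cap_lker_span _ _ _ _ F (Bfree 0)).
  exact: leq_trans (Bi _) (leq_addr _ _).
have fE v : v2r (v - projv F v) = (v2r \o (\1 - projv F)%VF) v.
  by rewrite /= add_lfunE opp_lfunE id_lfunE.
set M0 := \matrix_j v2r (B0 j - projv F (B0 j)).
rewrite -(leq_add2r (\rank M0)) (dim_cap_lker_span _ _ _ _ F B0free).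
rewrite -leq_subRL //.
pose M k := \matrix_i0 v2r (B k i0 - projv F (B k i0)).
apply: (@mxrank_limit_le _ _ _ M) => [l j|k].
  rewrite mxE fE; under eq_fun do rewrite mxE fE.
  exact: ccvg_linear.
rewrite leq_subRL // -[X in (_ <= X)%N](dim_cap_lker_span _ _ _ _ F (Bfree k)).
by rewrite leq_add2r; exact: Bi.
Qed.

End ComplexLimits.

(** * Osculating flags as divisibility and degree conditions *)

Section Flags.
Variable R : realType.
Local Notation C := R[i].
Variable d : nat.
Implicit Types (p : Polyd R d) (V : {vspace Polyd R d}).

Lemma val_topolyd (q : {poly C}) : (size q <= d.+1)%N ->
  (topolyd R d q : {poly C}) = q.
Proof. by move=> sq; rewrite /topolyd val_insubd [_ \is a _]sq. Qed.

Definition flag_factor (xi : option C) (j : nat) : {poly C} :=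
  if xi is Some z then ('X - z%:P) ^+ (d - j) else 1.

Lemma size_flag_factor xi j : (0 < size (flag_factor xi j) <= (d - j).+1)%N.
Proof.
by case: xi => [z|] /=; rewrite ?size_exp_XsubC ?size_poly1 ?leqnn.
Qed.

Lemma mem_osc_flag xi j p : (j <= d)%N ->
  p \in osc_flag R d xi j <->
  exists2 q : {poly C}, (size q <= j.+1)%N
    & (p : {poly C}) = flag_factor xi j * q.
Proof.
move=> jd; rewrite /osc_flag -/(flag_factor xi j).
have /andP[s0 s1] := size_flag_factor xi j.
(* [topolyd] returns 0 on excessive degree; here the degree is at most (d - j) + k <= d. *)
have gen k : (k <= j)%N ->
    (topolyd R d (flag_factor xi j * 'X^k) : {poly C})
      = flag_factor xi j * 'X^k.
  move=> kj; apply: val_topolyd; apply: leq_trans (size_polyMleq _ _) _.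
  by rewrite size_polyXn; lia.
split=> [|[q sq pE]].
  move: p; apply: span_ind => [|a u v [q sq uE] [r sr vE]|_ /mapP[k k_j ->]].
  - by exists 0; rewrite ?size_poly0 ?mulr0.
  - exists (a *: q + r); last by rewrite /= uE vE mulrDr scalerAr.
    rewrite (leq_trans (size_polyD _ _)) // geq_max sr andbT.
    exact: leq_trans (size_scale_leq _ _) sq.
  exists 'X^k; first by move: k_j; rewrite mem_iota size_polyXn.
  by rewrite gen //; move: k_j; rewrite mem_iota.
(* The coefficients of the quotient [q] are the coordinates of [p] on the generators. *)
have -> : p = \sum_(k < j.+1) q`_k *: topolyd R d (flag_factor xi j * 'X^k).
  apply: val_inj; rewrite /= raddf_sum /= pE.
  have {1}-> : q = \sum_(k < j.+1) q`_k *: 'X^k.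
    rewrite -poly_def; apply/polyP => i; rewrite coef_poly.
    by case: ltnP => // ji; rewrite nth_default // (leq_trans sq).
  rewrite mulr_sumr; apply: eq_bigr => k _.
  by rewrite /= gen ?leq_ord // scalerAr.
apply: memv_suml => k _; rewrite memvZ // memv_span //; apply/mapP.
by exists (k : nat) => //; rewrite mem_iota ltn_ord.
Qed.

(** [flag_sh] at [k] is the member of dimension [k], that is F_(k-1), hence the order d + 1 - k. At
    [k = 0] the formula still holds: degree at most d excludes nonzero multiples of (x -
    z)^(d+1). *)
Lemma mem_flag_at z k p : (k <= d.+1)%N ->
  (p \in flag_sh R d (Some z) k)
  = (('X - z%:P) ^+ (d.+1 - k) %| (p : {poly C})).
Proof.
case: k => [_|k kd].
  rewrite memv0 subn0; apply/eqP/idP => [->|zp]; first exact: dvdp0.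
  apply/val_inj/eqP; apply: contraTT (size_npoly p) => p0.
  by rewrite -ltnNge (leq_trans _ (dvdp_leq p0 zp)) // size_exp_XsubC.
rewrite subSS [flag_sh _ _ _ _]/=.
apply/idP/idP => [/(mem_osc_flag _ _ _ kd)[q _ ->]|].
  exact: dvdp_mulr.
move=> /dvdpP[q pE].
apply/(mem_osc_flag _ _ _ kd); exists q; last by rewrite mulrC.
have [->|q0] := eqVneq q 0; first by rewrite size_poly0.
have := size_npoly p; rewrite pE size_Mmonic ?monic_exp ?monicXsubC //.
by rewrite size_exp_XsubC; lia.
Qed.

Lemma mem_flag_infty k p : (k <= d.+1)%N ->
  (p \in flag_sh R d None k) = (size (p : {poly C}) <= k)%N.
Proof.
case: k => [_|k kd].
  by rewrite memv0 size_poly_leq0.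
rewrite [flag_sh _ _ _ _]/=.
apply/idP/idP => [/(mem_osc_flag _ _ _ kd)[q sq ->]|sp]; first by rewrite mul1r.
by apply/(mem_osc_flag _ _ _ kd); exists (p : {poly C}); rewrite ?mul1r.
Qed.

Lemma flag_sub xi k l : (k <= l <= d.+1)%N ->
  (flag_sh R d xi k <= flag_sh R d xi l)%VS.
Proof.
move=> kl; apply/subvP => p; case: xi => [z|].
  rewrite !mem_flag_at; try lia.
  by apply: dvdp_trans; apply: dvdp_exp2l; lia.
by rewrite !mem_flag_infty; lia.
Qed.

Lemma dim_cap_flag_leq V xi k l : (k <= l <= d.+1)%N ->
  (\dim (V :&: flag_sh R d xi k) <= \dim (V :&: flag_sh R d xi l))%N.
Proof. by move=> kl; apply/dimvS/capvS => //; exact: flag_sub. Qed.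

Lemma dim_cap_flag_ltn V xi k l p : (k <= l <= d.+1)%N ->
  p \in V -> p \in flag_sh R d xi l -> p \notin flag_sh R d xi k ->
  (\dim (V :&: flag_sh R d xi k) < \dim (V :&: flag_sh R d xi l))%N.
Proof.
move=> kl pV pl pk.
have sub : (V :&: flag_sh R d xi k <= V :&: flag_sh R d xi l)%VS.
  by apply/capvS => //; exact: flag_sub.
rewrite ltn_neqAle dimvS // andbT (dimv_leqif_eq sub).
apply: contraNneq pk => E.
have : p \in (V :&: flag_sh R d xi l)%VS by rewrite memv_cap pV.
by rewrite -E memv_cap => /andP[].
Qed.

(** One more order of vanishing at [z] is one linear condition, so the larger intersection is the
    smaller one plus at most a line. *)
Lemma dim_cap_flag_succ V z k : (k <= d)%N ->
  (\dim (V :&: flag_sh R d (Some z) k.+1)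
     <= (\dim (V :&: flag_sh R d (Some z) k)).+1)%N.
Proof.
move=> kd.
set F := (_ :&: flag_sh _ _ _ k)%VS; set G := (_ :&: _)%VS.
have [GF|] := boolP (G <= F)%VS; first by rewrite ltnW // ltnS dimvS.
case/subvPn => v vG vF.
suff sub : (G <= F + <[v]>)%VS.
  rewrite (leq_trans (dimvS sub)) // (leq_trans (dimv_add_leqif _ _)) //.
  by rewrite dim_vline; case: (v != 0); rewrite ?addn0 ?addn1.
move: vG vF; rewrite /F /G !memv_cap => /andP[vV]; rewrite vV andTb.
rewrite !mem_flag_at ?(leqW kd) // subSS subSn // => /dvdpP[qv vE] vF.
have qvz : qv.[z] != 0.
  apply: contraNneq vF => /eqP/factor_theorem[r qvE].
  by rewrite vE qvE -mulrA -exprS dvdp_mull.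
apply/subvP => u; rewrite memv_cap mem_flag_at // subSS.
move=> /andP[uV /dvdpP[qu uE]].
(* Chosen so that the cofactor of [u - a *: v] vanishes at [z], which raises the order by one. *)
pose a := qu.[z] / qv.[z].
rewrite -[u](subrK (a *: v)); apply: memv_add; last by rewrite memvZ ?memv_line.
rewrite memv_cap rpredB ?rpredZ //= mem_flag_at ?(leqW kd) // subSn //.
rewrite raddfB /= uE vE -mul_polyC mulrA -mulrBl exprS.
apply: dvdp_mul => //; rewrite dvdp_XsubCl; apply/rootP.
by rewrite !hornerE /a divfK ?subrr.
Qed.

End Flags.

(** * Criteria for Schubert cells and varieties *)

Section SchubertConditions.
Variable R : realType.
Local Notation C := R[i].
Variables N d : nat.
Implicit Types (V : {vspace Polyd R d}) (w : nat -> nat) (xi : option C).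

Lemma map_nth_enum_ord (T : Type) (x0 : T) (n : nat) (s : seq T) :
  size s = n -> [seq nth x0 s i | i : 'I_n <- enum 'I_n] = s.
Proof.
move=> <-; rewrite -[RHS](mkseq_nth x0) /mkseq -val_enum_ord -map_comp.
exact: eq_map.
Qed.

(** A constant sequence of bases exhibits [V] as a limit. *)
Lemma schubert_cell_variety w xi V :
  schubert_cell R N d w xi V -> schubert_variety R N d w xi V.
Proof.
move=> cV; have [dV _] := cV.
pose B0 (i : 'I_N.+1) := (vbasis V)`_i.
have B0E : map B0 (enum 'I_N.+1) = vbasis V.
  by apply: map_nth_enum_ord; rewrite size_tuple.
have VE : <<map B0 (enum 'I_N.+1)>>%VS = V.
  by rewrite B0E; exact: span_basis (vbasisP V).
have B0free : free (map B0 (enum 'I_N.+1)).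
  by rewrite B0E; exact: basis_free (vbasisP V).
exists (fun=> B0), B0; split=> // [|i c]; first by rewrite VE.
by split; exact: cvg_cst.
Qed.

(** Intersection dimensions can only jump up in a limit, so the equalities of the cell survive as
    lower bounds. *)
Lemma schubert_variety_dim w xi V : schubert_variety R N d w xi V ->
  \dim V = N.+1 /\
  forall i, (1 <= i <= N.+1)%N ->
    (i <= \dim (V :&: flag_sh R d xi (d - N + i - wext N w i)))%N.
Proof.
move=> [B [B0 [Bcell B0free -> Bcvg]]]; split=> [|i iN].
  by move/eqP: B0free; rewrite size_map size_enum_ord.
apply: (dim_cap_limit_ge _ _ _ _ _ B) => // k.
  by case: (Bcell k).
by have [_ [_ /(_ i iN)[-> _]]] := Bcell k.
Qed.

(** Each [p i] certifies a jump of the intersection dimension at [k i]. These are N + 1 jumps in a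
    space of dimension at most N + 1, so each is by exactly one and there are no others. *)
Lemma schubert_cell_witness w xi V (k : nat -> nat) (p : nat -> Polyd R d) :
  (\dim V <= N.+1)%N ->
  (forall i, 1 <= i <= N.+1 -> d - N + i - wext N w i = k i)%N ->
  (forall i, 1 <= i <= N -> k i < k i.+1)%N -> (k N.+1 <= d.+1)%N ->
  (forall i, 1 <= i <= N.+1 ->
    [&& 0 < k i, p i \in V, p i \in flag_sh R d xi (k i)
      & p i \notin flag_sh R d xi (k i).-1])%N ->
  schubert_cell R N d w xi V.
Proof.
move=> dV kE klt kd kp.
pose c i := \dim (V :&: flag_sh R d xi i).
have kd' i : (1 <= i <= N.+1 -> k i <= d.+1)%N.
  have [j] := ubnP (N.+1 - i)%N; elim: j i => // j IH i ij iN.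
  have [->//|iN'] := eqVneq i N.+1.
  have := klt i ltac:(lia); have := IH i.+1 ltac:(lia) ltac:(lia); lia.
have cS i : (1 <= i <= N.+1 -> c (k i).-1 < c (k i))%N.
  move=> iN; have /and4P[k0 pV pk pk'] := kp i iN.
  by apply: (dim_cap_flag_ltn _ _ _ _ _ _ (p i)) => //; have := kd' i iN; lia.
have cM i : (1 <= i <= N -> c (k i) <= c (k i.+1).-1)%N.
  move=> iN; apply: dim_cap_flag_leq.
  by have := klt i iN; have := kd' i.+1 ltac:(lia); lia.
(* Counting the jumps from the bottom. *)
have lower i : (1 <= i <= N.+1 -> i <= c (k i))%N.
  elim: i => // i IH iN; have := cS i.+1 iN.
  have [->|i0] := posnP i; first lia.
  have := cM i ltac:(lia); have := IH ltac:(lia); lia.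
have cV : (c (k N.+1) <= \dim V)%N by apply/dimvS/capvSl.
have dVE : \dim V = N.+1.
  by apply/eqP; rewrite eqn_leq dV (leq_trans (lower _ _)) // ltn0Sn leqnn.
(* Counting from the top: descending from [\dim V <= N.+1], each jump loses at least one. *)
have upper i : (1 <= i <= N.+1 -> c (k i) <= i)%N.
  have [j] := ubnP (N.+1 - i)%N; elim: j i => // j IH i ij iN.
  have [->|iN'] := eqVneq i N.+1; first exact: leq_trans cV dV.
  have := cM i ltac:(lia); have := cS i.+1 ltac:(lia).
  have := IH i.+1 ltac:(lia) ltac:(lia); lia.
split=> // i iN.
suff : c (k i) = i /\ c (k i).-1 = i.-1 by rewrite -(kE i iN).
have := lower i iN; have := upper i iN; have := cS i iN.
have [->|i1] := eqVneq i 1%N; first lia.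
have := cM i.-1 ltac:(lia); have := lower i.-1 ltac:(lia).
have -> : i.-1.+1 = i by lia.
by lia.
Qed.

(** The dimension must climb from at most 1 at index d + 1 - N to N + 1 at index d + 1. These are N
    steps of at most one each, so every step is exactly one, as the conditions for i >= 2
    require. *)
Lemma schubert_cell_special z V :
  (0 < N <= d)%N -> \dim V = N.+1 ->
  (0 < \dim (V :&: flag_sh R d (Some z) 1))%N ->
  (\dim (V :&: flag_sh R d (Some z) (d.+1 - N)) <= 1)%N ->
  schubert_cell R N d (fun l => if l == 1%N then (d - N)%N else 0%N) (Some z) V.
Proof.
move=> Nd dV c1 cN; split=> // i iN.
pose c i := \dim (V :&: flag_sh R d (Some z) i).
have cd : c d.+1 = N.+1.
  rewrite -dV /c; congr (\dim _); apply/capv_idPl/subvP => p _.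
  by rewrite mem_flag_at // subnn expr0 dvd1p.
have cM j l : (j <= l <= d.+1 -> c j <= c l)%N by exact: dim_cap_flag_leq.
have cS j l : (j + l <= d.+1 -> c (j + l) <= c j + l)%N.
  elim: l => [|l IH] jl; first by rewrite !addn0.
  rewrite !addnS (leq_trans (dim_cap_flag_succ _ _ _ _ _ _)) //; first lia.
  by rewrite ltnS; apply: IH; lia.
have c0 : c 0 = 0%N by rewrite /c /= capv0 dimv0.
rewrite -/(c _) in c1; rewrite -/(c _) in cN.
set w := fun l : nat => if l == 1%N then (d - N)%N else 0%N.
suff : c (d - N + i - wext N w i)%N = i
    /\ c (d - N + i - wext N w i).-1 = i.-1 by [].
have [i1|i1] := eqVneq i 1%N.
  have -> : (d - N + i - wext N w i = 1)%N.
    by rewrite /wext /w i1 /=; case: ifP; lia.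
  rewrite i1 c0; split=> //; have := cM 1%N (d.+1 - N)%N ltac:(lia); lia.
have -> : (d - N + i - wext N w i = d.+1 - N + i.-1)%N.
  by rewrite /wext /w (negPf i1); case: ifP; lia.
have := cS (d.+1 - N)%N i.-1 ltac:(lia).
have := cS (d.+1 - N + i.-1)%N (N.+1 - i)%N ltac:(lia).
have -> : (d.+1 - N + i.-1 + (N.+1 - i) = d.+1)%N by lia.
have -> : (d.+1 - N + i.-1).-1 = (d.+1 - N + i.-2)%N by lia.
have := cS (d.+1 - N)%N i.-2 ltac:(lia).
have := cS (d.+1 - N + i.-2)%N 1%N ltac:(lia).
have -> : (d.+1 - N + i.-2 + 1 = d.+1 - N + i.-1)%N by lia.
by rewrite cd; lia.
Qed.

End SchubertConditions.

(** * Multiplicity bounds for sparse polynomials and the operator (x + 1) d/dx - d *)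

Section SparsePolynomials.
Variable F : numFieldType.
Implicit Types (p : {poly F}).

Lemma dvdp_XsubC_exp_deriv (z : F) k p :
  ('X - z%:P) ^+ k.+1 %| p -> ('X - z%:P) ^+ k %| p^`().
Proof.
move=> /dvdpP[q ->]; rewrite derivM dvdp_add //.
  by rewrite exprS mulrA dvdp_mull.
by rewrite deriv_exp mulrnAr -mulrnAl dvdp_mull // dvdp_mull.
Qed.

(* Descartes-type bound by induction on the support s = e :: s': the operator
   X d/dX - e removes e from the support and lowers the multiplicity of z by at
   most one. *)
Lemma sparse_poly_root (z : F) (s : seq nat) p :
  z != 0 -> (forall e, e \notin s -> p`_e = 0) ->
  ('X - z%:P) ^+ size s %| p -> p = 0.
Proof.
move=> z0; elim: s p => [p p0 _|e s IH p ps zp].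
  by apply/polyP => i; rewrite p0 // coef0.
have zp' : ('X - z%:P) ^+ size s %| p.
  by apply: dvdp_trans zp; rewrite dvdp_exp2l.
have q0 : 'X * p^`() - p *+ e = 0.
  apply: IH => [i i_s|]; last first.
    rewrite dvdp_sub ?dvdp_mull //; first exact: dvdp_XsubC_exp_deriv.
    by rewrite -mulr_natl dvdp_mull.
  have qi : ('X * p^`() - p *+ e)`_i = p`_i *+ i - p`_i *+ e.
    by rewrite coefB coefXM coefMn coef_deriv; case: i {i_s}.
  rewrite qi; have [->|ie] := eqVneq i e; first by rewrite subrr.
  by rewrite ps ?inE ?negb_or ?ie // !mul0rn subrr.
(* [q0] reads (i - e) p_i = 0 for all i; in characteristic zero only the exponent [e] survives. *)
have pE : p = p`_e *: 'X^e.
  apply/polyP => i; rewrite coefZ coefXn.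
  have [->|ie] := eqVneq i e; first by rewrite mulr1.
  move/(congr1 (fun q : {poly F} => q`_i))/eqP: q0.
  rewrite mulr0 coef0 coefB coefXM coefMn coef_deriv.
  have -> : (if i == 0%N then 0 else p`_i.-1.+1 *+ i.-1.+1) = p`_i *+ i.
    by case: (i).
  rewrite subr_eq0 -subr_eq0 -[_ *+ i]mulr_natr -[_ *+ e]mulr_natr -mulrBr.
  by rewrite mulf_eq0 subr_eq0 eqr_nat (negPf ie) orbF => /eqP.
have : root p z.
  by rewrite -dvdp_XsubCl (dvdp_trans _ zp) //= exprS dvdp_mulr.
rewrite {1}pE /root !hornerE mulf_eq0 expf_eq0 (negPf z0) andbF orbF => /eqP pe.
by rewrite pE pe scale0r.
Qed.

(** The form ['X - 0%:P] is the one [mem_flag_at] produces at the point 0. *)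
Lemma dvdp_X_exp k p :
  ('X - 0%:P) ^+ k %| p <-> (forall j, (j < k)%N -> p`_j = 0).
Proof.
rewrite subr0; split=> [/dvdpP[q ->] j jk|pk]; first by rewrite coefMXn jk.
rewrite -(poly_take_drop k p); have -> : take_poly k p = 0.
  by apply/polyP => j; rewrite coef_take_poly coef0; case: ltnP => // /pk.
by rewrite add0r dvdp_mull.
Qed.

(* Kills ('X + 1) ^+ d, and maps every other truncation P_{m;d} to a multiple
   of 'X^m. *)
Definition euler_op (d : nat) p := ('X + 1) * p^`() - p *+ d.

Lemma euler_op_linear d k p q :
  euler_op d (k *: p + q) = k *: euler_op d p + euler_op d q.
Proof.
rewrite /euler_op derivD derivZ mulrDr mulrnDl opprD addrACA.
by rewrite -scalerAr scalerMnr -scalerBr.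
Qed.

Lemma coef_euler_op d p j :
  (euler_op d p)`_j = p`_j *+ j + p`_j.+1 *+ j.+1 - p`_j *+ d.
Proof.
rewrite /euler_op mulrDl mul1r coefB coefD coefXM coefMn !coef_deriv.
by case: j.
Qed.

(** Differentiation lowers the order at -1 by at most one, and the factor x + 1 restores it. *)
Lemma dvdp_XsubC_exp_euler_op (z : F) d k p : z = -1 ->
  ('X - z%:P) ^+ k %| p -> ('X - z%:P) ^+ k %| euler_op d p.
Proof.
move=> -> zp; rewrite dvdp_sub //; last by rewrite -mulr_natl dvdp_mull.
case: k zp => [_|k zp]; first by rewrite expr0 dvd1p.
by rewrite exprS dvdp_mul ?dvdp_XsubC_exp_deriv // polyCN opprK ?dvdpp.
Qed.

(** The equation says (j + 1) p_(j+1) = (d - j) p_j, the recursion of the binomial coefficients. *)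
Lemma euler_op_eq0 d p : (size p <= d.+1)%N -> euler_op d p = 0 ->
  forall j, p`_j = p`_0 * 'C(d, j)%:R.
Proof.
move=> sp Lp; elim=> [|j IH]; first by rewrite bin0 mulr1.
have [dj|jd] := leqP d j.
  by rewrite nth_default ?bin_small ?mulr0 ?(leq_trans sp).
move/(congr1 (fun q : {poly F} => q`_j)): Lp; rewrite coef_euler_op coef0.
have j0 : j.+1%:R != 0 :> F by rewrite pnatr_eq0.
move=> E; apply: (mulfI j0); rewrite mulrCA -natrM mul_bin_left natrM.
rewrite natrB 1?ltnW // mulrCA -IH mulrBl !mulr_natl.
by move/eqP: E; rewrite subr_eq0 addrC => /eqP <-; rewrite addrK.
Qed.

End SparsePolynomials.

(** * Position of the truncated binomials in the flags *)

Section TruncatedBinomials.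
Variable R : realType.
Local Notation C := R[i].
Variable d : nat.

Lemma coef_trunc_binom m j :
  (trunc_binom R m d)`_j = if (j <= m)%N then 'C(d, j)%:R else 0.
Proof.
by rewrite /trunc_binom -(poly_def _ (fun j => 'C(d, j)%:R)) coef_poly ltnS.
Qed.

Lemma size_trunc_binom m : (m <= d)%N -> size (trunc_binom R m d) = m.+1.
Proof.
move=> md; rewrite /trunc_binom -(poly_def _ (fun j => 'C(d, j)%:R)).
rewrite size_poly_eq //=.
by rewrite pnatr_eq0 -lt0n bin_gt0.
Qed.

Lemma trunc_binom_full : trunc_binom R d d = ('X - (-1)%:P) ^+ d.
Proof.
rewrite polyCN opprK polyC1 addrC exprDn; apply: eq_bigr => j _.
by rewrite expr1n mul1r scaler_nat.
Qed.

Definition truncp m := topolyd R d (trunc_binom R m d).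

Lemma truncpE m : (m <= d)%N -> (truncp m : {poly C}) = trunc_binom R m d.
Proof. by move=> md; rewrite val_topolyd // size_trunc_binom. Qed.

Lemma truncp_flag_infty m k : (m <= d)%N -> (k <= d.+1)%N ->
  (truncp m \in flag_sh R d None k) = (m < k)%N.
Proof.
by move=> md kd; rewrite mem_flag_infty // truncpE // size_trunc_binom.
Qed.

(** The difference has order exactly m + 1 at 0, its lowest coefficient being the binomial of d over
    m + 1, nonzero since m < d. *)
Lemma sub_truncp_flag_0 m k : (m < d)%N -> (k <= d.+1)%N ->
  (truncp d - truncp m \in flag_sh R d (Some 0) k) = (d - m <= k)%N.
Proof.
move=> md kd; rewrite mem_flag_at // raddfB /= !truncpE ?(ltnW md) //.
apply/idP/idP => [/dvdp_X_exp E|mk]; last apply/dvdp_X_exp => j jk.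
  rewrite leqNgt; apply/negP => km; have /eqP := E m.+1 ltac:(lia).
  rewrite coefB !coef_trunc_binom md ltnn subr0 pnatr_eq0 -leqn0 leqNgt.
  by rewrite bin_gt0 md.
rewrite coefB !coef_trunc_binom; have -> : (j <= m)%N by lia.
have -> : (j <= d)%N by lia.
by rewrite subrr.
Qed.

Lemma truncp_full_flag_0 k : (k <= d.+1)%N ->
  (truncp d \in flag_sh R d (Some 0) k) = (d < k)%N.
Proof.
move=> kd; rewrite mem_flag_at // !truncpE //.
apply/idP/idP => [/dvdp_X_exp E|mk]; last by apply/dvdp_X_exp => j; lia.
rewrite ltnNge; apply/negP => km; have /eqP := E 0 ltac:(lia).
by rewrite coef_trunc_binom bin0 oner_eq0.
Qed.

(** Below m the binomial recursion cancels everything, above m all terms are zero, and at m the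
    cancellation occurs when m = d. *)
Lemma euler_op_truncp m j : (m <= d)%N -> (j == m -> m == d) ->
  (euler_op _ d (truncp m : {poly C}))`_j = 0.
Proof.
move=> md jm; rewrite coef_euler_op truncpE // !coef_trunc_binom.
have [jm'|mj|mj] := ltngtP j m.
- rewrite -!mulrnA -mulrnDr -mulrnBr; last first.
    by have := mul_bin_left d j; have := leq_trans jm' md; nia.
  have -> : ('C(d, j) * j + 'C(d, j.+1) * j.+1 - 'C(d, j) * d = 0)%N.
    by have := mul_bin_left d j; have := leq_trans jm' md; nia.
  by rewrite mulr0n.
- by rewrite !mul0rn addr0 subrr.
- by rewrite mul0rn addr0 mj in jm *; rewrite -(eqP (jm (eqxx _))) subrr.
Qed.

(** The cofactor of the degree-d polynomial (x + 1)^d must be constant. This is how the condition at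
    -1 yields (x + 1)^d itself. *)
Lemma flag_1E : flag_sh R d (Some (-1)) 1 = <[truncp d]>%VS.
Proof.
apply/vspaceP => p; rewrite mem_flag_at // subSS subn0.
rewrite -trunc_binom_full -truncpE //.
apply/idP/vlineP => [|[k ->]]; last by rewrite /= -mul_polyC dvdp_mull.
move=> /dvdpP[q pE]; have := size_npoly p.
have [q0|q0] := eqVneq q 0.
  by exists 0; apply/val_inj; rewrite /= pE q0 mul0r scale0r.
rewrite pE truncpE // trunc_binom_full size_Mmonic ?monic_exp ?monicXsubC //.
rewrite size_exp_XsubC addnS /= addnC -[X in (_ <= X)%N]addn1 leq_add2l.
move=> /size1_polyC qE.
exists q`_0; apply/val_inj; rewrite /= truncpE // pE {1}qE mul_polyC.
by rewrite truncpE.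
Qed.

(* U is the direct sum of its parts of degree <= m and of order > m at 0, and
   the corresponding splitting of (x + 1)^d is P_{m;d} + (rest). *)
Lemma truncp_mem_split (U : {vspace Polyd R d}) m : (m < d)%N ->
  (0 < \dim (U :&: flag_sh R d (Some (-1)%R) 1))%N ->
  (\dim U <= \dim (U :&: flag_sh R d None m.+1)
             + \dim (U :&: flag_sh R d (Some 0%R) (d - m)))%N ->
  truncp d \in U /\ truncp m \in U.
Proof.
move=> md dQ; set A := (U :&: _)%VS; set B := (U :&: _)%VS => dAB.
have QU : truncp d \in U.
  have : (U :&: flag_sh R d (Some (-1)) 1)%VS != 0%VS.
    by rewrite -dimv_eq0 -lt0n.
  rewrite -vpick0; set v := vpick _ => v0.
  have : v \in (U :&: flag_sh R d (Some (-1)) 1)%VS by exact: memv_pick.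
  rewrite flag_1E memv_cap => /andP[vU /vlineP[k vE]].
  have k0 : k != 0 by apply: contraNneq v0 => k0; rewrite vE k0 scale0r.
  by rewrite -[truncp d](scalerK k0) -vE memvZ.
split=> //.
have AB0 : (A :&: B = 0)%VS.
  apply/eqP; rewrite -subv0; apply/subvP => p.
  rewrite memv_cap => /andP[/memv_capP[_ pA] /memv_capP[_ pB]].
  move: pA pB; rewrite mem_flag_infty ?(leqW md) //.
  rewrite mem_flag_at ?leq_subLR; last lia.
  have -> : (d.+1 - (d - m) = m.+1)%N by lia.
  move=> sp /dvdp_X_exp p0; rewrite memv0; apply/eqP/val_inj/polyP => j /=.
  rewrite coef0; have [/p0//|mj] := ltnP j m.+1.
  by rewrite nth_default // (leq_trans sp).
have ABU : (A + B)%VS = U.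
  apply/eqP; rewrite eqEdim dimv_disjoint_sum // dAB andbT.
  by rewrite subv_add !capvSl.
move: QU; rewrite -{1}ABU => /memv_addP[u uA [v vB Quv]].
move: uA vB; rewrite !memv_cap => /andP[uU uA] /andP[_ vB].
suff -> : truncp m = u by [].
move: uA vB; rewrite mem_flag_infty ?(leqW md) // mem_flag_at; last lia.
have -> : (d.+1 - (d - m) = m.+1)%N by lia.
move=> su /dvdp_X_exp v0; apply/val_inj/polyP => j /=.
rewrite truncpE ?(ltnW md) // coef_trunc_binom; case: leqP => [jm|mj].
  have := congr1 (fun p : Polyd R d => (p : {poly C})`_j) Quv.
  rewrite raddfD /= coefD v0 ?ltnS // addr0 truncpE // coef_trunc_binom.
  by rewrite (leq_trans jm) // ltnW.
by rewrite nth_default // (leq_trans su).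
Qed.

End TruncatedBinomials.

(** * The span V and bounds on its exponents *)

Section Theorem4.
Variable R : realType.
Local Notation C := R[i].
Variables (N d : nat) (m : nat -> nat).
Hypothesis N_gt0 : (1 <= N)%N.
Hypothesis m_lt : forall i, (1 <= i < N)%N -> (m i < m i.+1)%N.
Hypothesis mN_lt : (m N < d)%N.

Let V : {vspace Polyd R d} :=
  <<[seq topolyd R d (trunc_binom R (m l) d) | l <- iota 1 N]
      ++ [:: topolyd R d (trunc_binom R d d)]>>%VS.
Let a := fun l => (m (N.+1 - l) - (N - l))%N.
Let w := fun l => (d - m l - (N.+1 - l))%N.
Let special := fun l => if l == 1%N then (d - N)%N else 0%N.

(** Strict increase gains at least one per index. The consequences [m_ltd] and [m_ge] keep the
    truncated subtractions in [w] and [a] exact. *)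
Lemma m_gap i j : (1 <= i <= j)%N -> (j <= N)%N -> (m i + (j - i) <= m j)%N.
Proof.
elim: j => [|j IH] ij jN; first lia.
have [->|ij'] := eqVneq i j.+1; first lia.
have := IH ltac:(lia) ltac:(lia); have := m_lt j ltac:(lia); lia.
Qed.

Lemma m_ltd i : (1 <= i <= N)%N -> (m i + (N - i) < d)%N.
Proof. by move=> iN; have := m_gap i N ltac:(lia) ltac:(lia); lia. Qed.

Lemma m_ge i : (1 <= i <= N)%N -> (i.-1 <= m i)%N.
Proof. by move=> iN; have := m_gap 1 i ltac:(lia) ltac:(lia); lia. Qed.

Lemma N_le_d : (N <= d)%N.
Proof. by have := m_ltd 1 ltac:(lia); lia. Qed.

Lemma dim_V_le : (\dim V <= N.+1)%N.
Proof.
by apply: leq_trans (dim_span _) _; rewrite size_cat size_map size_iota addn1.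
Qed.

Lemma truncp_V l : (1 <= l <= N)%N -> truncp R d (m l) \in V.
Proof.
move=> lN; apply: memv_span; rewrite mem_cat; apply/orP; left.
by apply/mapP; exists l => //; rewrite mem_iota; lia.
Qed.

Lemma truncp_full_V : truncp R d d \in V.
Proof. by apply: memv_span; rewrite mem_cat mem_head orbT. Qed.

(** * Existence: V lies in the three cells *)

Lemma V_cell_0 : schubert_cell R N d a (Some 0) V.
Proof.
have Nd := N_le_d; have gap := m_gap; have ltd := m_ltd; have ge := m_ge.
(* Order o at 0 means a jump at d + 1 - o. The witnesses have order m_(N+1-i) + 1, and the last one,
   (x + 1)^d, has order 0. *)
apply: (schubert_cell_witness _ _ _ _ _ _
  (fun i => if (i <= N)%N then (d - m (N.+1 - i))%N else d.+1)
  (fun i => truncp R d d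
     - if (i <= N)%N then truncp R d (m (N.+1 - i)) else 0)).
- exact: dim_V_le.
- move=> i iN; rewrite /wext /a; case: (leqP i N) => iN'; last lia.
  have := ltd (N.+1 - i)%N ltac:(lia); have := ge (N.+1 - i)%N ltac:(lia); lia.
- move=> i iN; have -> : (i <= N)%N by lia.
  case: (leqP i.+1 N) => iN'; last lia.
  have := ltd (N.+1 - i)%N ltac:(lia).
  have := gap (N.+1 - i.+1)%N (N.+1 - i)%N ltac:(lia) ltac:(lia); lia.
- by rewrite ltnn.
move=> i iN; case: (leqP i N) => iN'; last first.
  rewrite subr0 truncp_full_V !truncp_full_flag_0 //=; lia.
have md := ltd (N.+1 - i)%N ltac:(lia).
rewrite rpredB ?truncp_full_V ?truncp_V ?sub_truncp_flag_0; lia.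
Qed.

Lemma V_cell_infty : schubert_cell R N d w None V.
Proof.
have Nd := N_le_d; have gap := m_gap; have ltd := m_ltd; have ge := m_ge.
(* A polynomial of degree e gives a jump at e + 1; the degrees are m_1, ..., m_N and d. *)
apply: (schubert_cell_witness _ _ _ _ _ _
  (fun i => if (i <= N)%N then (m i).+1 else d.+1)
  (fun i => truncp R d (if (i <= N)%N then m i else d))).
- exact: dim_V_le.
- move=> i iN; rewrite /wext /w; case: (leqP i N) => iN'; last lia.
  have := ltd i ltac:(lia); have := ge i ltac:(lia); lia.
- move=> i iN; have -> : (i <= N)%N by lia.
  case: (leqP i.+1 N) => iN'; last first.
    by rewrite ltnS; have := ltd i ltac:(lia); lia.
  by have := gap i i.+1 ltac:(lia) ltac:(lia); lia.
- by rewrite ltnn.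
move=> i iN; case: (leqP i N) => iN'; last first.
  by rewrite truncp_full_V !truncp_flag_infty //=; lia.
by have md := ltd i ltac:(lia); rewrite truncp_V ?truncp_flag_infty; lia.
Qed.

Lemma dim_V : \dim V = N.+1.
Proof. by case: V_cell_infty. Qed.

Lemma euler_op_V p j : p \in V -> j \notin [seq m l | l <- iota 1 N] ->
  (euler_op _ d (p : {poly C}))`_j = 0.
Proof.
move=> pV jm; move: p pV.
apply: span_ind => [|k u v|p].
- by rewrite coef_euler_op !coef0 !mul0rn addr0 subrr.
- by move=> u0 v0; rewrite /= euler_op_linear coefD coefZ u0 v0 mulr0 addr0.
rewrite mem_cat => /orP[/mapP[l lN ->]|]; last first.
  by rewrite inE => /eqP->; exact: euler_op_truncp.
apply: euler_op_truncp.
  by have := m_ltd l; move: lN; rewrite mem_iota; lia.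
by move=> /eqP jl; rewrite jl map_f in jm.
Qed.

Lemma V_cell_special : schubert_cell R N d special (Some (-1)) V.
Proof.
have Nd := N_le_d.
apply: schubert_cell_special; [lia|exact: dim_V| |].
  rewrite flag_1E lt0n dimv_eq0 -subv0; apply/subvPn; exists (truncp R d d).
    by rewrite memv_cap truncp_full_V memv_line.
  rewrite memv0 -val_eqE /= truncpE // -size_poly_eq0 size_trunc_binom //.
(* Index d + 1 - N means order at least N at -1. *)
suff sub : (V :&: flag_sh R d (Some (-1)) (d.+1 - N) <= <[truncp R d d]>)%VS.
  by apply: leq_trans (dimvS sub) _; rewrite dim_vline leq_b1.
apply/subvP => p; rewrite memv_cap mem_flag_at ?leq_subr // => /andP[pV].
rewrite subKn; last lia.
(* The scalar is the constant coefficient because that of (x + 1)^d is 1. *)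
move=> pN; apply/vlineP; exists (p : {poly C})`_0.
apply/val_inj/polyP => j; rewrite /= coefZ truncpE // coef_trunc_binom.
have -> : (if (j <= d)%N then 'C(d, j)%:R else 0) = 'C(d, j)%:R :> C.
  by case: leqP => // dj; rewrite bin_small.
apply: euler_op_eq0; first exact: size_npoly.
(* The image of [p] has at most N exponents and order at least N at -1, so it vanishes. *)
apply: (sparse_poly_root _ (-1) [seq m l | l <- iota 1 N]).
- by rewrite oppr_eq0 oner_eq0.
- by move=> e eN; exact: euler_op_V.
by rewrite size_map size_iota; apply: dvdp_XsubC_exp_euler_op.
Qed.

(** * Uniqueness of the point of intersection *)

Lemma inter_unique (U : {vspace Polyd R d}) :
  schubert_variety R N d a (Some 0) U ->
  schubert_variety R N d special (Some (-1)) U ->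
  schubert_variety R N d w None U -> U = V.
Proof.
move=> /schubert_variety_dim[dU U0] /schubert_variety_dim[_ U1].
move=> /schubert_variety_dim[_ Uoo].
have Nd := N_le_d; have ltd := m_ltd; have ge := m_ge.
(* Condition l at infinity and condition N + 1 - l at 0 together give N + 1 = dim U, the bound
   needed for the splitting at m_l. *)
have key l : (1 <= l <= N)%N -> truncp R d d \in U /\ truncp R d (m l) \in U.
  move=> lN; have mld := ltd l lN; have mge := ge l lN.
  apply: truncp_mem_split; first lia.
    (* The first special condition has index d - N + 1 - (d - N) = 1. *)
    have := U1 1%N ltac:(lia); rewrite /wext N_gt0 /special eqxx.
    by rewrite addnC addnK.
  rewrite dU; have := U0 (N.+1 - l)%N ltac:(lia); have := Uoo l ltac:(lia).
  have -> : (d - N + l - wext N w l = (m l).+1)%N.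
    by rewrite /wext /w; case: leqP; lia.
  have -> : (d - N + (N.+1 - l) - wext N a (N.+1 - l) = d - m l)%N.
    rewrite /wext /a; have -> : (N.+1 - l <= N)%N by lia.
    have -> : (N.+1 - (N.+1 - l) = l)%N by lia.
    by lia.
  by lia.
(* The dimensions agree, so it suffices that U contains the generators of V. *)
apply/eqP; rewrite eq_sym eqEdim dU dim_V leqnn andbT.
apply/span_subvP => p; rewrite mem_cat => /orP[/mapP[l lN ->]|].
  by case: (key l) => //; move: lN; rewrite mem_iota; lia.
by rewrite inE => /eqP->; case: (key 1%N) => //; lia.
Qed.

End Theorem4.

Theorem theorem4 (R : realType) (N d : nat) (m : nat -> nat) :
  (1 <= N)%N ->
  (forall i, (1 <= i < N)%N -> (m i < m i.+1)%N) ->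
  (m N < d)%N ->
  let V : {vspace Polyd R d} :=
    <<[seq topolyd R d (trunc_binom R (m l) d) | l <- iota 1 N]
        ++ [:: topolyd R d (trunc_binom R d d)]>>%VS in
  let a := fun l => (m (N.+1 - l) - (N - l))%N in
  let w := fun l => (d - m l - (N.+1 - l))%N in
  let special := fun l => if l == 1%N then (d - N)%N else 0%N in
  let inter (U : {vspace Polyd R d}) :=
    [/\ schubert_variety R N d a (Some 0) U,
        schubert_variety R N d special (Some (-1)) U &
        schubert_variety R N d w None U] in
  [/\ \dim V = N.+1, inter V & forall U, inter U -> U = V].
Proof.
move=> N_gt0 m_lt mN_lt V a w special inter; split.
- exact: dim_V.
- by split; apply: schubert_cell_variety;
    [exact: V_cell_0|exact: V_cell_special|exact: V_cell_infty].
- by move=> U [U0 U1 Uoo]; exact: inter_unique.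
Qed.
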